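(* The operator $C\in\mathcal L(X_2,Y)$ is spectrally coercive if and only if there exist functions $\psi,\varepsilon\in\mathfrak C$ such that the following resolvent inequality holds: $$\|z\|_X^2\le \inf\left\{\frac{\|Cz\|_Y^2}{\psi(\lambda(z))},\ \frac{\|(A-\lambda I)z\|_X^2}{(\lambda-\lambda(z))^2+\varepsilon(\lambda(z))}\right\}\qquad \forall \lambda\in\mathbb R,\ \forall z\in X_2\setminus\{0\}.$$
   Context: $X$ and $Y$ are complex Hilbert spaces. $A$ is a linear unbounded self-adjoint, strictly positive operator on $X$ with compact resolvent. $X_2=D(A)$ with the norm $\|z\|_2=\|Az\|_X$, and $\mathcal L(X_2,Y)$ is the space of bounded linear operators from $X_2$ to $Y$. For $z\in X_2\setminus\{0\}$ the $A$-frequency is $\lambda(z)=\langle Az,z\rangle_X\|z\|_X^{-2}$. $\mathfrak C$ is the set of continuous decreasing functions $\psi:\mathbb R_+\to(0,\infty)$, where $\mathbb R_+=[0,\infty)$ and ''decreasing'' is understood in the non-strict sense (constant functions belong to $\mathfrak C$). $C$ is called spectrally coercive if there exist $\varepsilon,\psi\in\mathfrak C$ such that, whenever $z\in X_2\setminus\{0\}$ satisfies $\frac{\|Az\|_X^2}{\|z\|_X^2}-\lambda^2(z)<\varepsilon(\lambda(z))$, one has $\|Cz\|_Y^2\ge\psi(\lambda(z))\|z\|_X^2$.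
   Formalization: The infimum of the two quantities is replaced by their maximum: with the infimum the inequality fails at every eigenvector z of A for λ=λ(z), although C=I (Y=X) is spectrally coercive, so the printed equivalence is false. *)

(* Defs.v *)
From HB Require Import structures.
From mathcomp Require Import all_boot all_order all_algebra.
From mathcomp Require Import complex.
From mathcomp Require Import all_classical all_reals all_analysis.

Set Implicit Arguments.
Unset Strict Implicit.
Unset Printing Implicit Defensive.

Import Order.TTheory GRing.Theory Num.Theory.
Import numFieldNormedType.Exports.

Local Open Scope classical_set_scope.
Local Open Scope ring_scope.

(* [inner] is linear in its first argument and conjugate-linear in the second. *)
HB.mixin Record CompleteNormedModule_isHilbert (R : realType) (X : Type)
    of CompleteNormedModule R[i]%C X := {
  inner : {dot X for (@Num.conj R[i]%C)} ;
  norm_inner : forall x : X, `|x| ^+ 2 = inner x x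
}.

#[short(type="hilbertType")]
HB.structure Definition Hilbert (R : realType) :=
  { X of CompleteNormedModule_isHilbert R X & CompleteNormedModule R[i]%C X }.

(* The norm of a normed module over [R[i]] is a (real) element of [R[i]];
   [hnorm] is the same number as an element of [R]. *)
Definition hnorm (R : realType) (X : hilbertType R) (x : X) : R :=
  complex.Re `|x|.

(* A linear operator defined on the subspace [dom]; the values of the
   underlying function outside [dom] are irrelevant. *)
Record unbounded_op (R : realType) (X : hilbertType R) := UnboundedOp {
  dom : set X ;
  op_fun :> X -> X ;
  dom0 : dom 0 ;
  domP : forall (a : R[i]%C) (x y : X), dom x -> dom y -> dom (a *: x + y) ;
  op_linear : forall (a : R[i]%C) (x y : X), dom x -> dom y ->
    op_fun (a *: x + y) = a *: op_fun x + op_fun y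
}.

Definition op_graph (R : realType) (X : hilbertType R) (A : unbounded_op X) :
  set (X * X) := [set p | dom A p.1 /\ p.2 = A p.1].

(* The pairs (y, w) with y in D(A^* ) and w = A^* y (the graph of a function as
   soon as D(A) is dense). *)
Definition adjoint_graph (R : realType) (X : hilbertType R)
  (A : unbounded_op X) : set (X * X) :=
  [set p | forall x, dom A x -> inner (A x) p.1 = inner x p.2].

Definition self_adjoint (R : realType) (X : hilbertType R)
  (A : unbounded_op X) : Prop :=
  dense (dom A) /\ adjoint_graph A = op_graph A.

(* The order of [R[i]] makes [0 < c] say that [c] is real and positive. For a
   self-adjoint operator with compact resolvent it is equivalent to having some
   [m > 0] such that <Az, z> >= m |z|^2 on the domain. *)
Definition strictly_positive (R : realType) (X : hilbertType R)
  (A : unbounded_op X) : Prop :=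
  forall z, dom A z -> z != 0 -> 0 < inner (A z) z.

(* [mu] is in the resolvent set of [A] and [T] is the inverse of
   A - mu I : D(A) -> X, a bounded operator on X. *)
Definition is_resolvent (R : realType) (X : hilbertType R)
  (A : unbounded_op X) (mu : R[i]%C) (T : {linear X -> X}) : Prop :=
  [/\ continuous T,
      forall x, dom A (T x) /\ A (T x) - mu *: T x = x
    & forall z, dom A z -> T (A z - mu *: z) = z].

Definition compact_operator (R : realType) (X : hilbertType R)
  (T : {linear X -> X}) : Prop := precompact (T @` closed_ball (0 : X) 1).

Definition compact_resolvent (R : realType) (X : hilbertType R)
  (A : unbounded_op X) : Prop :=
  exists (mu : R[i]%C) (T : {linear X -> X}),
    is_resolvent A mu T /\ compact_operator T.

Definition norm2 (R : realType) (X : hilbertType R)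
  (A : unbounded_op X) (z : X) : R := hnorm (A z).

(* [C] belongs to L(D(A), Y), where D(A) carries the norm [norm2 A]; the values
   of [C] outside D(A) are irrelevant. *)
Definition bounded_on_dom (R : realType) (X Y : hilbertType R)
  (A : unbounded_op X) (C : X -> Y) : Prop :=
  (forall (a : R[i]%C) (x y : X), dom A x -> dom A y ->
     C (a *: x + y) = a *: C x + C y) /\
  (exists M : R, forall z, dom A z -> hnorm (C z) <= M * norm2 A z).

(* <Az, z> is real for a self-adjoint [A], so the real part loses nothing. *)
Definition frequency (R : realType) (X : hilbertType R)
  (A : unbounded_op X) (z : X) : R :=
  complex.Re (inner (A z) z) / hnorm z ^+ 2.

(* Functions [0, +oo[ -> ]0, +oo[ are represented by functions on [R] of which
   only the restriction to [0, +oo[ matters. *)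
Definition frakC (R : realType) (psi : R -> R) : Prop :=
  [/\ {within `[0, +oo[, continuous psi},
      forall s t : R, 0 <= s -> s <= t -> psi t <= psi s
    & forall t : R, 0 <= t -> 0 < psi t].

Definition spectrally_coercive (R : realType) (X Y : hilbertType R)
  (A : unbounded_op X) (C : X -> Y) : Prop :=
  exists eps psi : R -> R, [/\ frakC eps, frakC psi
    & forall z, dom A z -> z != 0 ->
        hnorm (A z) ^+ 2 / hnorm z ^+ 2 - frequency A z ^+ 2
          < eps (frequency A z) ->
        psi (frequency A z) * hnorm z ^+ 2 <= hnorm (C z) ^+ 2].

(* Main.v *)
(* The variance identity
   [|(A - lambda) z|^2 = ((lambda - lambda(z))^2 + V(z)) |z|^2], where
   [V(z) = |Az|^2 / |z|^2 - lambda(z)^2], turns each condition into the other: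
   if [V(z)] is at least [eps], the second entry of the maximum dominates
   [|z|^2] for every [lambda]; conversely, at [lambda = lambda(z)] the second
   entry is [V(z) |z|^2 / eps], which is below [|z|^2] when [V(z) < eps]. *)
Require Import Defs.
From HB Require Import structures.
From mathcomp Require Import all_boot all_order all_algebra.
From mathcomp Require Import complex.
From mathcomp Require Import all_classical all_reals all_analysis.
From mathcomp Require Import ring.

Import Order.TTheory GRing.Theory Num.Theory.
Import numFieldNormedType.Exports.

Local Open Scope classical_set_scope.
Local Open Scope ring_scope.

Section Hilbert.
Context {R : realType} {X : hilbertType R}.
Implicit Types (x y z : X) (l : R).

Lemma hnormE x : `|x| = (hnorm x)%:C%C.
Proof. by rewrite /hnorm RRe_real// ger0_real. Qed.

Lemma hnorm_gt0 x : x != 0 -> 0 < hnorm x.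
Proof. by rewrite -normr_gt0 hnormE ltcR. Qed.

Lemma sqr_hnorm x : hnorm x ^+ 2 = complex.Re (inner x x).
Proof. by rewrite -norm_inner hnormE -rmorphXn. Qed.

(** Since [l] is real, conjugation fixes it and the two cross terms are conjugate to each other, so
    only a real part survives. *)
Lemma sqr_hnorm_subZ l x y : hnorm (x - l%:C%C *: y) ^+ 2 =
  hnorm x ^+ 2 - 2 * l * complex.Re (inner x y) + l ^+ 2 * hnorm y ^+ 2.
Proof.
have conj_l : Num.conj l%:C%C = l%:C%C := conjc_real l.
rewrite !sqr_hnorm hnormB !linearZl_LR !linearZr_LR /= expr0 mul1r conj_l /GRing.scale /=.
case: (inner x x) (inner y y) (inner x y) => [a a'] [b b'] [c c'] /=.
ring.
Qed.

Context (A : unbounded_op X).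

(** For self-adjoint [A], the variance of its spectral measure at the unit vector [z / |z|]. *)
Definition frequency_variance z : R :=
  hnorm (A z) ^+ 2 / hnorm z ^+ 2 - frequency A z ^+ 2.

(** Members of [frakC] are known to be positive only on the half-line, so they may be evaluated at a
    frequency only once its sign is known. *)
Lemma frequency_ge0 z : strictly_positive A -> dom A z -> z != 0 ->
  0 <= frequency A z.
Proof.
move=> hpos zA z0; rewrite divr_ge0 ?sqr_ge0//.
by have := hpos z zA z0; rewrite ltcE => /andP[_ /ltW].
Qed.

(** Completing the square in [l]: the cross term [Re <Az, z>] is the frequency times [|z|^2]. *)
Lemma sqr_hnorm_shift l z : z != 0 -> hnorm (A z - l%:C%C *: z) ^+ 2 =
  ((l - frequency A z) ^+ 2 + frequency_variance z) * hnorm z ^+ 2.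
Proof.
move=> z0; rewrite sqr_hnorm_subZ /frequency_variance /frequency.
by have := hnorm_gt0 _ z0 => /lt0r_neq0 ?; field.
Qed.

End Hilbert.

Theorem theorem3p1 (R : realType) (X Y : hilbertType R)
  (A : unbounded_op X) (hA : self_adjoint A) (hpos : strictly_positive A)
  (hcomp : compact_resolvent A)
  (C : X -> Y) (hC : bounded_on_dom A C) :
  spectrally_coercive A C <->
  exists psi eps : R -> R, [/\ frakC psi, frakC eps
    & forall (lambda : R) (z : X), dom A z -> z != 0 ->
        hnorm z ^+ 2 <=
          Num.max (hnorm (C z) ^+ 2 / psi (frequency A z))
                  (hnorm (A z - lambda%:C%C *: z) ^+ 2 /
                     ((lambda - frequency A z) ^+ 2 + eps (frequency A z)))].
Proof.
split=> [[eps [psi [epsC psiC coerc]]]|[psi [eps [psiC epsC resolv]]]].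
- exists psi, eps; split=> // l z zA z0.
  have f0 := frequency_ge0 _ _ hpos zA z0.
  have [_ _ /(_ _ f0) psi0] := psiC; have [_ _ /(_ _ f0) eps0] := epsC.
  rewrite le_max; have [small|large] := ltP (frequency_variance A z)
    (eps (frequency A z)).
    by rewrite ler_pdivlMr// mulrC coerc.
  (* The square [(l - frequency A z) ^+ 2] occurs in both numerator and denominator, so only
     [eps <= V(z)] remains to compare. *)
  apply/orP; right; rewrite sqr_hnorm_shift// ler_pdivlMr; last first.
    by rewrite ltr_wpDl ?sqr_ge0.
  by rewrite mulrC ler_wpM2r ?sqr_ge0 ?lerD2l.
- exists eps, psi; split=> // z zA z0 small.
  have f0 := frequency_ge0 _ _ hpos zA z0.
  have [_ _ /(_ _ f0) psi0] := psiC; have [_ _ /(_ _ f0) eps0] := epsC.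
  have := resolv (frequency A z) z zA z0.
  rewrite sqr_hnorm_shift// subrr expr0n/= !add0r le_max => /orP[|].
    by rewrite ler_pdivlMr// mulrC.
  (* Cancelling [|z|^2] in the second alternative leaves [eps <= V(z)], which contradicts
     [small]. *)
  rewrite ler_pdivlMr// mulrC ler_pM2r ?exprn_gt0 ?hnorm_gt0//.
  by rewrite leNgt small.
Qed.
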